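(* Let $\mathbb{A}=\mathbb{R}[X^{\pm}]$, let $\mathbb{A}^+ = \mathbb{R}_{\ge0}[X^{\pm}]\setminus\{0\}$, let $n\ge 3$, and let $\mathcal{M}$ be an $\mathbb{A}$-submodule of $\mathbb{A}^n$. Write $\boldsymbol{f}=(f_S,f_K,\ldots)$ for elements of $\mathbb{A}^n$, where $f_S,f_K$ denote the first and second coordinates. Then $\mathcal{M}$ contains an element $\boldsymbol{f}=(f_S,f_K,\ldots)\in(\mathbb{A}^+)^n$ with $\deg_+(f_S)+1\ge\deg_+(f_K)$ and $\deg_-(f_S)\le\deg_-(f_K)$ if and only if the following three conditions are all satisfied: (i) for each $r\in\mathbb{R}_{>0}$ there exists $\boldsymbol{f}_r\in\mathcal{M}$ such that $\boldsymbol{f}_r(r)\in\mathbb{R}_{>0}^n$; (ii) there exists $\boldsymbol{f}_\infty=(f_{\infty,S},f_{\infty,K},\ldots)\in\mathcal{M}$ such that $\mathrm{lc}_+(\boldsymbol{f}_\infty)\in\mathbb{R}_{>0}^n$ and $\deg_+(f_{\infty,S})+1\ge\deg_+(f_{\infty,K})$; (iii) there exists $\boldsymbol{f}_0=(f_{0,S},f_{0,K},\ldots)\in\mathcal{M}$ such that $\mathrm{lc}_-(\boldsymbol{f}_0)\in\mathbb{R}_{>0}^n$ and $\deg_-(f_{0,S})\le\deg_-(f_{0,K})$.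
   Context: $\mathbb{R}[X^{\pm}]$ is the ring of univariate real Laurent polynomials; $\mathbb{R}_{\ge0}[X^{\pm}]$ is the subset of those with non-negative coefficients. For a non-zero $f=\sum_{i=p}^q a_iX^i$ with $a_p,a_q\ne0$: $\deg_-(f)=p$, $\deg_+(f)=q$, $\mathrm{lc}_-(f)=a_p$, $\mathrm{lc}_+(f)=a_q$; also $\deg_-(0)=+\infty$, $\deg_+(0)=-\infty$, $\mathrm{lc}_\pm(0)=0$. For a tuple $\boldsymbol{f}=(f_1,\dots,f_n)$, $\mathrm{lc}_\pm(\boldsymbol{f})$ and the evaluation $\boldsymbol{f}(r)$ are taken coordinatewise. *)

(* Defs.v *)
From HB Require Import structures.
From mathcomp Require Import all_boot all_order all_algebra.
From mathcomp Require Import finmap.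
From mathcomp Require Import classical_sets reals constructive_ereal.

Set Implicit Arguments.
Unset Strict Implicit.
Unset Printing Implicit Defensive.

Import Order.TTheory GRing.Theory Num.Theory.
Local Open Scope fset_scope.
Local Open Scope ring_scope.

(* [f i] is the coefficient of X^i.  A wrapper type is needed because
   multinomials' {malg R[K]} requires K to be a monoid without non-trivial
   units, which excludes int, and so provides no product here. *)
Record laurent (R : comNzRingType) : predArgType :=
  Laurent { lcoef :> {fsfun int -> R with 0} }.

HB.instance Definition _ (R : comNzRingType) := [isNew for @lcoef R].
HB.instance Definition _ (R : comNzRingType) := [Choice of laurent R by <:].
Bind Scope ring_scope with laurent.

Section LaurentRing.
Variable R : comNzRingType.
Implicit Types f g h : laurent R.

Lemma laurentP f g : (forall i, f i = g i) <-> f = g.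
Proof.
by split=> [h|->//]; case: f g h => [f] [g] /= h; congr Laurent; apply/fsfunP.
Qed.

Definition laurent0 : laurent R := Laurent [fsfun].
Definition laurent1 : laurent R := Laurent [fsfun i in [fset 0%:Z] => 1].
Definition laurent_opp f : laurent R :=
  Laurent [fsfun i in finsupp f => - f i].
Definition laurent_add f g : laurent R :=
  Laurent [fsfun i in finsupp f `|` finsupp g => f i + g i].
Definition laurent_mul f g : laurent R :=
  Laurent [fsfun k in [fset (i + j)%R | i in finsupp f, j in finsupp g] =>
             \sum_(i <- finsupp f) f i * g (k - i)].

Lemma laurent0E i : laurent0 i = 0.
Proof. by rewrite /= fsfun0E. Qed.

Lemma laurent1E i : laurent1 i = (i == 0)%:R.
Proof. by rewrite /= fsfunE inE; case: eqP. Qed.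

Lemma laurent_oppE f i : laurent_opp f i = - f i.
Proof. by rewrite /= fsfunE; case: finsuppP => //; rewrite oppr0. Qed.

Lemma laurent_addE f g i : laurent_add f g i = f i + g i.
Proof.
rewrite /= fsfunE inE; case: ifPn => // /norP[/fsfun_dflt-> /fsfun_dflt->].
by rewrite addr0.
Qed.

Lemma sum_finsuppW (S : {fset int}) f (F : int -> R) :
  finsupp f `<=` S ->
  \sum_(i <- finsupp f) f i * F i = \sum_(i <- S) f i * F i.
Proof.
move=> sfS; apply: (big_fset_incl _ sfS) => i _ Hi.
by rewrite fsfun_dflt ?mul0r.
Qed.

Lemma laurent_mulE f g k :
  laurent_mul f g k = \sum_(i <- finsupp f) f i * g (k - i).
Proof.
rewrite /= fsfunE; case: ifPn => // kN; rewrite big_seq big1 // => i fi.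
have [gki|/fsfun_dflt->] := boolP (k - i \in finsupp g); last by rewrite mulr0.
by case/negP: kN; apply/imfset2P; exists i => //; exists (k - i); rewrite // subrKC.
Qed.

Lemma laurent_addA : associative laurent_add.
Proof. by move=> f g h; apply/laurentP=> i; rewrite !laurent_addE addrA. Qed.

Lemma laurent_addC : commutative laurent_add.
Proof. by move=> f g; apply/laurentP=> i; rewrite !laurent_addE addrC. Qed.

Lemma laurent_add0 : left_id laurent0 laurent_add.
Proof. by move=> f; apply/laurentP=> i; rewrite laurent_addE laurent0E add0r. Qed.

Lemma laurent_addN : left_inverse laurent0 laurent_opp laurent_add.
Proof.
by move=> f; apply/laurentP=> i; rewrite laurent_addE laurent_oppE laurent0E addNr.
Qed.

Lemma laurent_mulC : commutative laurent_mul.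
Proof.
suff H f g k : laurent_mul f g k =
    \sum_(i <- finsupp f) \sum_(j <- finsupp g | i + j == k) f i * g j.
  move=> f g; apply/laurentP=> k; rewrite !H.
  under eq_bigr do rewrite big_mkcond.
  rewrite exchange_big /=; apply: eq_bigr => j _; rewrite [RHS]big_mkcond.
  by apply: eq_bigr => i _; rewrite addrC mulrC.
rewrite laurent_mulE; apply: eq_bigr => i _.
under eq_bigl => j do rewrite addrC eq_sym -subr_eq.
have [gki|gki] := boolP (k - i \in finsupp g).
  rewrite big_mkcond (big_fsetD1 _ gki) /= eqxx big_seq big1 ?addr0 // => j.
  by rewrite !inE eq_sym => /andP[/negPf->].
rewrite (fsfun_dflt gki) mulr0 big_seq_cond big1 // => j /andP[gj /eqP ej].
by rewrite ej gj in gki.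
Qed.

Lemma laurent_mulA : associative laurent_mul.
Proof.
move=> f g h; rewrite [laurent_mul g h]laurent_mulC [RHS]laurent_mulC.
apply/laurentP=> k; rewrite !laurent_mulE.
under eq_bigr do rewrite laurent_mulE mulr_sumr.
rewrite exchange_big /=; apply: eq_bigr => l _; rewrite laurent_mulE mulr_sumr.
by apply: eq_bigr => i _; rewrite mulrCA addrAC.
Qed.

Lemma laurent_mul1 : left_id laurent1 laurent_mul.
Proof.
move=> f; apply/laurentP=> k; rewrite laurent_mulE.
rewrite (@sum_finsuppW [fset 0%:Z]); first by rewrite big_seq_fset1 laurent1E eqxx mul1r subr0.
by apply/fsubsetP => i; rewrite mem_finsupp laurent1E inE; case: (i == 0) => //; rewrite eqxx.
Qed.

Lemma laurent_mulDl : left_distributive laurent_mul laurent_add.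
Proof.
move=> f g h; apply/laurentP=> k; rewrite laurent_addE !laurent_mulE.
have sU : finsupp (laurent_add f g) `<=` finsupp f `|` finsupp g.
  apply/fsubsetP => i; rewrite inE !mem_finsupp laurent_addE -negb_and.
  by apply: contraNN => /andP[/eqP-> /eqP->]; rewrite addr0.
rewrite (sum_finsuppW _ sU) (sum_finsuppW _ (fsubsetUl _ (finsupp g))).
rewrite (sum_finsuppW _ (fsubsetUr (finsupp f) _)) -big_split /=.
by apply: eq_bigr => i _; rewrite -mulrDl; congr (_ * _); apply: laurent_addE.
Qed.

Lemma laurent1_neq0 : laurent1 != laurent0.
Proof.
apply/eqP => /laurentP/(_ 0); rewrite laurent0E laurent1E eqxx.
by move/eqP; rewrite oner_eq0.
Qed.

End LaurentRing.

HB.instance Definition _ (R : comNzRingType) := GRing.isZmodule.Build (laurent R)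
  (@laurent_addA R) (@laurent_addC R) (@laurent_add0 R) (@laurent_addN R).
HB.instance Definition _ (R : comNzRingType) :=
  GRing.Zmodule_isComNzRing.Build (laurent R) (@laurent_mulA R)
    (@laurent_mulC R) (@laurent_mul1 R) (@laurent_mulDl R) (@laurent1_neq0 R).

Section LaurentDegree.
Variable R : comNzRingType.
Implicit Type f : laurent R.

Definition deg_plus f : \bar int := \big[maxe/-oo%E]_(i <- finsupp f) i%:E.
Definition deg_minus f : \bar int := \big[mine/+oo%E]_(i <- finsupp f) i%:E.

Definition lc_plus f : R := if deg_plus f is i%:E%E then f i else 0.
Definition lc_minus f : R := if deg_minus f is i%:E%E then f i else 0.

End LaurentDegree.

(* Only meaningful for r != 0: the library's 0 ^ i is 0 for negative i. *)
Definition laurent_eval (F : fieldType) (f : laurent F) (r : F) : F :=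
  \sum_(i <- finsupp f) f i * r ^ i.

Definition laurent_pos (R : numDomainType) : set (laurent R) :=
  [set f : laurent R | f != 0 /\ forall i : int, 0 <= f i].

Arguments laurent_pos R : clear implicits.

Section LaurentDegreeTheory.
Variable R : comNzRingType.
Implicit Type f : laurent R.

Lemma laurent_coef1 i : (1 : laurent R) i = (i == 0)%:R.
Proof. exact: laurent1E. Qed.

Lemma laurent_coefD f g i : (f + g) i = f i + g i.
Proof. exact: laurent_addE. Qed.

Lemma laurent_coefM f g k : (f * g) k = \sum_(i <- finsupp f) f i * g (k - i).
Proof. exact: laurent_mulE. Qed.

Lemma finsupp_laurent0 : finsupp (0 : laurent R) = fset0.
Proof. exact: finsupp0. Qed.

Lemma deg_plus0 : deg_plus (0 : laurent R) = -oo%E.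
Proof. by rewrite /deg_plus finsupp_laurent0 big_seq_fset0. Qed.

Lemma deg_minus0 : deg_minus (0 : laurent R) = +oo%E.
Proof. by rewrite /deg_minus finsupp_laurent0 big_seq_fset0. Qed.

Lemma bigmaxe_intP (s : seq int) (q : int) :
  \big[maxe/-oo%E]_(i <- s) i%:E%E = q%:E%E <->
  q \in s /\ {in s, forall i : int, i <= q}.
Proof.
have H (t : seq int) : t != [::] -> exists2 p, p \in t &
    \big[maxe/-oo%E]_(i <- t) i%:E%E = p%:E%E /\ {in t, forall i : int, i <= p}.
  elim: t => // x t IH _; case: (eqVneq t [::]) => [->|/IH[p pt [E le_p]]].
    exists x; rewrite ?mem_head // big_cons big_nil max_l ?leNye //.
    by split=> // i; rewrite inE => /eqP->.
  exists (Num.max x p); first by rewrite maxEle; case: ifP; rewrite !inE ?pt ?eqxx ?orbT.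
  rewrite big_cons E EFin_max; split=> // i; rewrite inE le_max.
  by move=> /orP[/eqP->|/le_p->]; rewrite ?lexx ?orbT.
split=> [E|[qs le_q]]; last first.
  have [|p ps [-> le_p]] := H s; first by case: (s) qs.
  by congr (_%:E)%E; apply/le_anti; rewrite le_q ?le_p.
have [|p ps [E' le_p]] := H s; first by apply: contra_eqN E => /eqP->; rewrite big_nil.
by move: E; rewrite E' => -[<-].
Qed.

Lemma bigmine_intP (s : seq int) (q : int) :
  \big[mine/+oo%E]_(i <- s) i%:E%E = q%:E%E <->
  q \in s /\ {in s, forall i : int, q <= i}.
Proof.
have H (t : seq int) : t != [::] -> exists2 p, p \in t &
    \big[mine/+oo%E]_(i <- t) i%:E%E = p%:E%E /\ {in t, forall i : int, p <= i}.
  elim: t => // x t IH _; case: (eqVneq t [::]) => [->|/IH[p pt [E le_p]]].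
    exists x; rewrite ?mem_head // big_cons big_nil min_l ?leey //.
    by split=> // i; rewrite inE => /eqP->.
  exists (Num.min x p); first by rewrite minEle; case: ifP; rewrite !inE ?pt ?eqxx ?orbT.
  rewrite big_cons E EFin_min; split=> // i; rewrite inE ge_min.
  by move=> /orP[/eqP->|/le_p->]; rewrite ?lexx ?orbT.
split=> [E|[qs le_q]]; last first.
  have [|p ps [-> le_p]] := H s; first by case: (s) qs.
  by congr (_%:E)%E; apply/le_anti; rewrite le_q ?le_p.
have [|p ps [E' le_p]] := H s; first by apply: contra_eqN E => /eqP->; rewrite big_nil.
by move: E; rewrite E' => -[<-].
Qed.

Lemma deg_plusP f (q : int) :
  deg_plus f = q%:E%E <-> f q != 0 /\ forall i : int, q < i -> f i = 0.
Proof.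
rewrite -mem_finsupp bigmaxe_intP; split=> -[qf H]; split=> // i.
  by move=> lt_qi; apply: fsfun_dflt; apply: contraTN lt_qi => /H; rewrite leNgt.
by rewrite mem_finsupp leNgt; apply: contraNN => /H->.
Qed.

Lemma deg_minusP f (p : int) :
  deg_minus f = p%:E%E <-> f p != 0 /\ forall i : int, i < p -> f i = 0.
Proof.
rewrite -mem_finsupp bigmine_intP; split=> -[pf H]; split=> // i.
  by move=> lt_ip; apply: fsfun_dflt; apply: contraTN lt_ip => /H; rewrite leNgt.
by rewrite mem_finsupp leNgt; apply: contraNN => /H->.
Qed.

End LaurentDegreeTheory.

(* Main.v *)
(* Two elements of the module can be merged: if f > 0 on (0,b], g > 0 to the right
   of some a < b, and a < c < b, then (c/X)^N f + (X/c)^N g is positive on both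
   ranges for large N, because the first term dominates on (0,a], both are positive
   on [a,b], and the second dominates beyond b.  The lowest term of the result comes
   from f and the highest from g, so the degree conditions survive.  Starting from
   f_0, a supremum argument using the local elements f_r extends positivity to
   (0,r] for every r; merging with f_oo gives an element that is positive on (0,oo)
   and has positive extreme coefficients.  By Polya's theorem, multiplying by a high
   power of 1 + X then makes all coefficients non-negative. *)
Require Import Defs.
From mathcomp Require Import all_boot all_order all_algebra.
From mathcomp Require Import finmap zify ring lra.
From mathcomp Require Import all_classical all_reals topology normedtype derive.
Import Order.TTheory GRing.Theory Num.Theory numFieldNormedType.Exports.
Set Implicit Arguments.
Unset Strict Implicit.

Local Open Scope classical_set_scope.
Local Open Scope ring_scope.

(** * Laurent polynomials and their evaluation *)

Section Laurent.
Variable R : comNzRingType.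
Implicit Types (f g : laurent R) (p q : int).

Definition lmono (c : R) (k : int) : laurent R :=
  Laurent [fsfun i in [fset k]%fset => c].

Lemma coef_lmonoM c k f i : (lmono c k * f) i = c * f (i - k).
Proof.
have E j : lmono c k j = if j == k then c else 0 by rewrite /= fsfunE inE.
rewrite laurent_coefM (@sum_finsuppW _ [fset k]%fset); last first.
  apply/fsubsetP => j; rewrite mem_finsupp E inE; case: (j == k) => //.
  by rewrite eqxx.
by rewrite big_seq_fset1 E eqxx.
Qed.

Lemma laurent_support_bound f :
  exists p, [/\ forall i, i < - p -> f i = 0 & forall i, p < i -> f i = 0].
Proof.
(* The sum of the absolute values of all exponents dominates each of them, so one number bounds the
   support on both sides. *)
exists (\sum_(i <- finsupp f) `|i|).
have H i : (i \in finsupp f) -> `|i| <= \sum_(i <- finsupp f) `|i|.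
  move=> fi; rewrite (big_fsetD1 _ fi) /= lerDl.
  by apply: sumr_ge0 => j _; exact: normr_ge0.
by split=> i lti; apply: fsfun_dflt; apply: contraTN lti => /H; lia.
Qed.

(* One definition for both ends: for x != 0, f(x) = x^p (lpoly f p)(x) when p bounds
   the support from below, and f(x) = x^p (lpoly f p)(1/x) when it bounds it from above. *)
Definition lpoly f p : {poly R} := \sum_(i <- finsupp f) f i *: 'X^`|(i - p)%R|%N.

(** Common core of the two readings of [lpoly]: on the support of [f], only the exponent [m] may
    land on [k]. Here [m] is [p + k] when [p] bounds the support from below, and [p - k] when it
    bounds it from above. *)
Lemma coef_lpoly_sum f p k m :
  (forall i, f i != 0 -> (`|(i - p)%R|%N == k) = (i == m)) -> (lpoly f p)`_k = f m.
Proof.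
move=> H; rewrite /lpoly coef_sum.
have E i : (i \in finsupp f) -> (f i *: 'X^`|(i - p)%R|%N)`_k = if i == m then f i else 0.
  move=> fi; rewrite coefZ coefXn eq_sym H -?mem_finsupp //.
  by case: (i == m); rewrite ?mulr1 ?mulr0.
rewrite big_seq (eq_bigr _ E) -big_seq.
have [fm|fm] := boolP (m \in finsupp f).
  rewrite (big_fsetD1 _ fm) /= eqxx big_seq big1 ?addr0 // => i.
  by rewrite !inE => /andP[/negPf->].
rewrite (fsfun_dflt fm) big_seq big1 // => i fi.
by case: eqP => // im; rewrite -im fi in fm.
Qed.

Lemma coef_lpoly f p (k : nat) :
  (forall i, i < p -> f i = 0) -> (lpoly f p)`_k = f (p + k%:Z).
Proof.
move=> fp; apply: coef_lpoly_sum => i fi.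
have : p <= i by rewrite leNgt; apply: contra_neqN fi => /fp.
lia.
Qed.

Lemma coef_lpoly_rev f q (k : nat) :
  (forall i, q < i -> f i = 0) -> (lpoly f q)`_k = f (q - k%:Z).
Proof.
move=> fq; apply: coef_lpoly_sum => i fi.
have : i <= q by rewrite leNgt; apply: contra_neqN fi => /fq.
lia.
Qed.

Definition X1 : laurent R := 1 + lmono 1 1.

Lemma coef_X1M f i : (X1 * f) i = f i + f (i - 1).
Proof. by rewrite mulrDl laurent_coefD coef_lmonoM mul1r mul1r. Qed.

(** Carries Polya's theorem back to Laurent polynomials: multiplying by [1 + X] creates nothing
    below [p], so the same shift by [p] serves before and after. *)
Lemma lpoly_X1M f p N : (forall i, i < p -> f i = 0) ->
  (forall i, i < p -> (X1 ^+ N * f) i = 0) /\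
  lpoly (X1 ^+ N * f) p = (1 + 'X) ^+ N * lpoly f p.
Proof.
move=> fp; elim: N => [|N [IH1 IH2]]; first by rewrite !expr0 !mul1r.
have H i : i < p -> (X1 ^+ N.+1 * f) i = 0.
  by move=> ip; rewrite exprS -mulrA coef_X1M !IH1 ?addr0 //; lia.
split=> //; rewrite (exprS (1 + 'X)) -mulrA -IH2.
apply/polyP => k; rewrite coef_lpoly // mulrDl coefD mul1r coefXM !coef_lpoly //.
rewrite exprS -mulrA coef_X1M; congr (_ + _).
case: k => [|k] /=; first by rewrite IH1 //; lia.
by rewrite (_ : p + k.+1%:Z - 1 = p + k%:Z) //; lia.
Qed.

End Laurent.

Arguments X1 {R}.

Section LaurentEval.
Variable R : fieldType.
Implicit Types (f g : laurent R) (x : R).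

Lemma laurent_evalD f g x : laurent_eval (f + g) x = laurent_eval f x + laurent_eval g x.
Proof.
have sU : (finsupp (f + g)%R `<=` finsupp f `|` finsupp g)%fset.
  apply/fsubsetP => i; rewrite inE !mem_finsupp laurent_coefD -negb_and.
  by apply: contraNN => /andP[/eqP-> /eqP->]; rewrite addr0.
rewrite /laurent_eval (sum_finsuppW _ sU) (sum_finsuppW _ (fsubsetUl _ (finsupp g))).
rewrite (sum_finsuppW _ (fsubsetUr (finsupp f) _)) -big_split /=.
by apply: eq_bigr => i _; rewrite laurent_coefD mulrDl.
Qed.

Lemma laurent_eval_lmonoM c k f x : x != 0 ->
  laurent_eval (lmono c k * f) x = c * x ^ k * laurent_eval f x.
Proof.
move=> x0; rewrite /laurent_eval.
rewrite (@sum_finsuppW _ [fset (i + k)%R | i in finsupp f]%fset); last first.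
  apply/fsubsetP => i; rewrite mem_finsupp coef_lmonoM => fi.
  apply/imfsetP; exists (i - k); last by rewrite subrK.
  by rewrite /= mem_finsupp; apply: contraNneq fi => ->; rewrite mulr0.
rewrite big_imfset /=; last by move=> i j _ _ /addIr.
rewrite mulr_sumr; apply: eq_bigr => i _.
by rewrite coef_lmonoM addrK expfzDr //; ring.
Qed.

Lemma laurent_eval_lpoly f p x : x != 0 -> (forall i, i < p -> f i = 0) ->
  laurent_eval f x = x ^ p * (lpoly f p).[x].
Proof.
move=> x0 fp; rewrite /laurent_eval /lpoly horner_sum mulr_sumr.
rewrite big_seq [RHS]big_seq; apply: eq_bigr => i; rewrite mem_finsupp => fi.
have pi : p <= i by rewrite leNgt; apply: contra_neqN fi => /fp.
rewrite hornerZ hornerXn mulrCA; congr (_ * _).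
by rewrite exprnP -expfzDr //; congr (_ ^ _); lia.
Qed.

Lemma laurent_eval_lpoly_rev f q x : x != 0 -> (forall i, q < i -> f i = 0) ->
  laurent_eval f x = x ^ q * (lpoly f q).[x^-1].
Proof.
move=> x0 fq; rewrite /laurent_eval /lpoly horner_sum mulr_sumr.
rewrite big_seq [RHS]big_seq; apply: eq_bigr => i; rewrite mem_finsupp => fi.
have iq : i <= q by rewrite leNgt; apply: contra_neqN fi => /fq.
rewrite hornerZ hornerXn mulrCA; congr (_ * _).
by rewrite exprVn exprnN -expfzDr //; congr (_ ^ _); lia.
Qed.

End LaurentEval.

(** * Polya's theorem in one variable *)

Section Polya.
Variable R : realType.
Implicit Types (u : {poly R}) (x : R).

Lemma poly_min u (a b : R) : a <= b ->
  exists2 c, a <= c <= b & forall x, a <= x <= b -> u.[c] <= u.[x].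
Proof.
move=> ab; have cu : {within `[a, b], continuous (horner u)}.
  by apply: continuous_subspaceT => x; exact: continuous_horner.
by have [c ci H] := EVT_min ab cu; exists c => // x xi; apply: H.
Qed.

Lemma poly_pos_lb u (a b : R) : (forall x, a <= x <= b -> 0 < u.[x]) ->
  exists2 m, 0 < m & forall x, a <= x <= b -> m <= u.[x].
Proof.
move=> up; have [ab|ba] := leP a b.
  by have [c /up uc H] := poly_min u ab; exists u.[c].
(* The interval is empty, so any positive bound will do. *)
by exists 1 => // x /andP[ax xb]; have := le_trans ax xb; rewrite leNgt ba.
Qed.

Lemma coef_1DXn N k : ((1 + 'X : {poly R}) ^+ N)`_k = 'C(N, k)%:R.
Proof.
elim: N k => [|N IH] k; first by rewrite expr0 coef1 bin0n.
rewrite exprS mulrDl mul1r coefD coefXM !IH; case: k => [|k] /=.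
  by rewrite !bin0 addr0.
by rewrite binS natrD.
Qed.

(** Rescales the coefficient of [X^k] in [(1 + X)^N X^i] to a product of falling factorials. The
    [if] is needed because a truncated [k - i] would give ['C(N, 0) = 1]. *)
Lemma fact_bin_ffact N d i k : (i <= d)%N -> (k <= N + d)%N ->
  (k`! * (N + d - k)`! * (if k < i then 0 else 'C(N, k - i)) =
   N`! * (k ^_ i * (N + d - k) ^_ (d - i)))%N.
Proof.
move=> id kNd; case: ltnP => [ki|ik]; first by rewrite ffact_small // !muln0.
(* When [N + d - k < d - i], also [N < k - i], and both sides vanish. *)
have [le|gt] := leqP (d - i) (N + d - k); last first.
  by rewrite (ffact_small gt) bin_small ?muln0 //; lia.
rewrite -(ffact_fact ik) -(ffact_fact le).
have -> : (N + d - k - (d - i) = N - (k - i))%N by lia.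
have kN : (k - i <= N)%N by lia.
rewrite -(bin_fact kN); ring.
Qed.

Lemma leq_expl (a b i : nat) : (a <= b)%N -> (a ^ i <= b ^ i)%N.
Proof. by case: i => // i ab; rewrite leq_exp2r. Qed.

(** The error is [i^2 M^(i-1)], multiplied through by [M] to avoid a negative exponent at [i = 0].
    Going from [i] to [i + 1] adds at most [i] to the factor [i^2], and [i^2 + i <= (i + 1)^2]. *)
Lemma ffact_approx (a M i : nat) : (a <= M)%N ->
  (a ^_ i <= a ^ i)%N /\ (M * (a ^ i) <= M * a ^_ i + i ^ 2 * M ^ i)%N.
Proof.
move=> aM; elim: i => [|i [IH1 IH2]]; first by rewrite ffactn0 expn0; lia.
rewrite ffactnSr !expnSr; split; first by rewrite leq_mul // leq_subr.
have E : (a ^_ i * a <= a ^_ i * (a - i) + i * M ^ i)%N.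
  have : (a ^_ i <= M ^ i)%N by rewrite (leq_trans IH1) // leq_expl.
  have : (a <= a - i + i)%N by lia.
  move: (a ^_ i) (M ^ i)%N (a - i)%N => s t b; nia.
have := leq_mul IH2 (leqnn a); have := leq_mul2l M (a ^_ i * a) (a ^_ i * (a - i) + i * M ^ i).
rewrite E orbT => /= H1 H2.
have H3 : (M ^ i * a <= M ^ i * M)%N by rewrite leq_mul.
have H4 := leq_mul (leqnn (i ^ 2)) H3.
move: H1 H2 H4; move: (a ^ i)%N (a ^_ i)%N (M ^ i)%N (a - i)%N => r s t b.
rewrite !mulnDr !mulnDl -!mulnn.
nia.
Qed.


(** The two errors combine through [xy - x'y' = (x - x')y + x'(y - y')], each remaining factor being
    bounded by a power of [M]. *)
Lemma ffact2_approx (k M d i : nat) : (i <= d)%N -> (k <= M)%N ->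
  (k ^_ i * (M - k) ^_ (d - i) <= k ^ i * (M - k) ^ (d - i))%N /\
  (M * (k ^ i * (M - k) ^ (d - i)) <=
   M * (k ^_ i * (M - k) ^_ (d - i)) + (i ^ 2 + (d - i) ^ 2) * M ^ d)%N.
Proof.
move=> id kM.
have [A1 A2] := ffact_approx i kM.
have [B1 B2] := ffact_approx (d - i) (leq_subr k M).
have A3 : (k ^_ i <= M ^ i)%N.
  by rewrite (leq_trans A1) // leq_expl.
have B3 : ((M - k) ^ (d - i) <= M ^ (d - i))%N.
  by rewrite leq_expl // leq_subr.
split; first by rewrite leq_mul.
rewrite -{4}(subnKC id) expnD.
have C1 := leq_mul A2 (leqnn ((M - k) ^ (d - i))).
have C2 := leq_mul (leqnn (k ^_ i)) B2.
have C3 := leq_mul (leqnn (i ^ 2 * M ^ i)) B3.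
have C4 := leq_mul A3 (leqnn ((d - i) ^ 2 * M ^ (d - i))).
move: C1 C2 C3 C4.
move: (k ^ i)%N (k ^_ i)%N ((M - k) ^ (d - i))%N ((M - k) ^_ (d - i))%N
  (M ^ i)%N (M ^ (d - i))%N (i ^ 2)%N ((d - i) ^ 2)%N => a b c e f g h l.
lia.
Qed.

(** By compactness the homogenization of [u] is at least some [m > 0] on a segment. Suitably
    rescaled, the coefficients of [(1 + X)^N u] approximate its values there with an error of order
    [1 / N] uniform in [k]. *)
Lemma polya u d : (size u <= d.+1)%N -> 0 < u`_0 -> 0 < u`_d ->
  (forall x, 0 < x -> 0 < u.[x]) ->
  \forall N \near \oo, forall k, 0 <= ((1 + 'X) ^+ N * u)`_k.
Proof.
move=> su u0 ud upos.
have uE x : u.[x] = \sum_(i < d.+1) u`_i * x ^+ i by rewrite (horner_coef_wide _ su).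
(* The homogenization of u, restricted to the segment from (0,1) to (1,0). *)
pose h : {poly R} := \sum_(i < d.+1) u`_i *: ('X^i * (1 - 'X) ^+ (d - i)).
have hE t : h.[t] = \sum_(i < d.+1) u`_i * (t ^+ i * (1 - t) ^+ (d - i)).
  by rewrite /h horner_sum; apply: eq_bigr => i _; rewrite !hornerE.
have hpos t : 0 <= t <= 1 -> 0 < h.[t].
  (* At [t = 1] only the term [u_d] survives. Elsewhere [h(t)] is [(1 - t)^d u(x)] with
     [x = t / (1 - t)], and [x = 0] gives [u_0]. *)
  move=> /andP[t0 t1]; rewrite hE; have [->|t1'] := eqVneq t 1.
    rewrite big_ord_recr /= subnn expr0 big1 ?add0r ?expr1n ?mulr1 // => i _.
    by rewrite subrr expr0n subn_eq0 leqNgt ltn_ord /= !mulr0.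
  have t2 : 0 < 1 - t by rewrite subr_gt0 lt_neqAle t1'.
  have -> : \sum_(i < d.+1) u`_i * (t ^+ i * (1 - t) ^+ (d - i)) =
      (1 - t) ^+ d * u.[t / (1 - t)].
    rewrite uE mulr_sumr; apply: eq_bigr => i _.
    have -> : (1 - t) ^+ d = (1 - t) ^+ (d - i) * (1 - t) ^+ i.
      by rewrite -exprD subnK // -ltnS.
    by rewrite expr_div_n; field; rewrite expf_neq0 // gt_eqF.
  rewrite mulr_gt0 ?exprn_gt0 //; move: t0; rewrite le_eqVlt => /predU1P[<-|t0].
    by rewrite mul0r horner_coef0.
  by rewrite upos // divr_gt0.
have [m m0 mP] := poly_pos_lb hpos.
(* The errors of [ffact2_approx], weighted by the coefficients of [u]. *)
pose C := \sum_(i < d.+1) `|u`_i| * (i ^ 2 + (d - i) ^ 2)%:R.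
near=> N => k; have [kNd|kNd] := leqP k (N + d); last first.
  rewrite coefM big1 // => i _; rewrite coef_1DXn.
  have [Ni|iN] := ltnP N i; first by rewrite bin_small ?mul0r.
  by rewrite [u`__]nth_default ?mulr0 // (leq_trans su) //; lia.
set M := (N + d)%N in kNd *.
have M0 : 0 < M%:R :> R by rewrite ltr0n addn_gt0; apply/orP; left; near: N; exact: nbhs_infty_gt.
have CM : C <= m * M%:R.
  rewrite mulrC -ler_pdivrMr // (@le_trans _ _ N%:R) ?ler_nat ?leq_addr //.
  by near: N; exact: nbhs_infty_ger.
(* Rescaled by k! (M - k)! / N!, the k-th coefficient is the value at (k, M - k) of
   the homogenization of u with powers replaced by falling factorials; it differs
   from M^d h(k / M) by at most C M^(d-1). *)
pose s : R := (k`! * (M - k)`!)%:R.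
have s0 : 0 < s by rewrite ltr0n muln_gt0 !fact_gt0.
rewrite -(pmulr_rge0 _ s0).
have -> : s * ((1 + 'X) ^+ N * u)`_k =
    N`!%:R * \sum_(i < d.+1) u`_i * (k ^_ i * (M - k) ^_ (d - i))%:R.
  have uE' : u = \sum_(i < d.+1) u`_i *: 'X^i.
    apply/polyP => i; rewrite coef_sum.
    under eq_bigr do rewrite coefZ coefXn.
    have [id|di] := ltnP i d.+1.
      rewrite (bigD1 (Ordinal id)) //= eqxx mulr1 big1 ?addr0 // => j ji.
      by rewrite [i == j]eq_sym [(j : nat) == i](negPf ji) mulr0.
    rewrite nth_default ?(leq_trans su) // big1 // => j _.
    by rewrite gtn_eqF ?mulr0 // (leq_trans (ltn_ord j)).
  rewrite {1}uE' mulr_sumr coef_sum !mulr_sumr; apply: eq_bigr => i _.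
  have id : (i <= d)%N by rewrite -ltnS.
  rewrite [RHS]mulrCA -natrM -(fact_bin_ffact id kNd) natrM.
  rewrite -scalerAr coefZ coefMXn coef_1DXn mulrCA; congr (_ * (_ * _)).
  by case: ifP.
rewrite mulr_ge0 // -(pmulr_rge0 _ M0).
have H : M%:R * M%:R ^+ d * h.[k%:R / M%:R] - C * M%:R ^+ d <=
   M%:R * \sum_(i < d.+1) u`_i * (k ^_ i * (M - k) ^_ (d - i))%:R.
  rewrite hE /C mulr_sumr mulr_suml mulr_sumr -sumrB; apply: ler_sum => i _.
  have id : (i <= d)%N by rewrite -ltnS.
  have [F1 F2] := ffact2_approx id kNd.
  have -> : M%:R * M%:R ^+ d * (u`_i * ((k%:R / M%:R) ^+ i * (1 - k%:R / M%:R) ^+ (d - i))) =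
     u`_i * (M * (k ^ i * (M - k) ^ (d - i)))%:R.
    have -> : 1 - k%:R / M%:R = (M - k)%:R / M%:R :> R.
      by rewrite natrB //; field; rewrite gt_eqF.
    have -> : M%:R ^+ d = M%:R ^+ i * M%:R ^+ (d - i) :> R by rewrite -exprD subnKC.
    have Mz : M%:R != 0 :> R by rewrite gt_eqF.
    rewrite !natrM !natrX !expr_div_n.
    by field; rewrite !expf_neq0.
  have Mn : (0 < M)%N by rewrite -(ltr0n R).
  move: F1 F2; rewrite -(leq_pmul2l Mn).
  move: (M * (k ^ i * _))%N (k ^_ i * _)%N (_ ^ 2 + _)%N => P Q W.
  rewrite -(ler_nat R) -(ler_nat R P) natrD !natrM natrX => F1 F2.
  (* The sign of [u_i] is unknown; passing to its absolute value is sound because [F1] makes the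
     difference non-negative. *)
  have F3 : u`_i * (P%:R - M%:R * Q%:R) <= `|u`_i| * (W%:R * M%:R ^+ d).
    apply: le_trans (ler_wpM2r _ (ler_norm _)) _; first by rewrite subr_ge0.
    by rewrite ler_wpM2l ?normr_ge0 // lerBlDl.
  move: F3; rewrite mulrBr [u`_i * (M%:R * _)]mulrCA lerBlDl -lerBlDr mulrA; apply.
apply: le_trans H; rewrite [M%:R * _]mulrC -mulrA -[C * _]mulrC -mulrBr.
rewrite mulr_ge0 ?exprn_ge0 ?ler0n // subr_ge0 (le_trans CM) // mulrC.
rewrite ler_pM2l // mP // divr_ge0 ?ler0n //= ler_pdivrMr // mul1r ler_nat //.
Unshelve. all: by end_near.
Qed.

End Polya.

(** * Extreme coefficients *)

Section LeadingCoefficients.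
Variable R : numDomainType.
Implicit Types (f g : laurent R) (p q : int).

(** Packages the degree and the positive extreme coefficient with an exponent in [int], so that
    degree comparisons avoid extended integers. *)
Definition lowpos f p := 0 < f p /\ forall i, i < p -> f i = 0.
Definition highpos f q := 0 < f q /\ forall i, q < i -> f i = 0.

Lemma lowposP f p : lowpos f p -> deg_minus f = p%:E%E /\ lc_minus f = f p.
Proof.
move=> [fp f0]; have E : deg_minus f = p%:E%E by apply/deg_minusP; rewrite gt_eqF.
by rewrite /lc_minus E.
Qed.

Lemma highposP f q : highpos f q -> deg_plus f = q%:E%E /\ lc_plus f = f q.
Proof.
move=> [fp f0]; have E : deg_plus f = q%:E%E by apply/deg_plusP; rewrite gt_eqF.
by rewrite /lc_plus E.
Qed.

Lemma lc_minus_gt0 f : 0 < lc_minus f -> exists p, lowpos f p.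
Proof.
rewrite /lc_minus; case E : (deg_minus f) => [p||]; rewrite ?ltxx // => fp.
by exists p; split=> //; have /deg_minusP[] := E.
Qed.

Lemma lc_plus_gt0 f : 0 < lc_plus f -> exists q, highpos f q.
Proof.
rewrite /lc_plus; case E : (deg_plus f) => [q||]; rewrite ?ltxx // => fq.
by exists q; split=> //; have /deg_plusP[] := E.
Qed.

Lemma lowpos_X1M f p N : lowpos f p -> lowpos (X1 ^+ N * f) p.
Proof.
move=> fp; elim: N => [|N [IH1 IH2]]; first by rewrite expr0 mul1r.
rewrite exprS -mulrA; split=> [|i ip]; rewrite coef_X1M.
  by rewrite [X in _ + X]IH2 ?addr0 //; lia.
by rewrite !IH2 ?addr0 //; lia.
Qed.

Lemma highpos_X1M f q N : highpos f q -> highpos (X1 ^+ N * f) (q + N%:Z).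
Proof.
move=> fp; elim: N => [|N [IH1 IH2]]; first by rewrite expr0 mul1r addr0.
rewrite exprS -mulrA; split=> [|i ip]; rewrite coef_X1M.
  by rewrite IH2 ?add0r; [rewrite (_ : _ - 1 = q + N%:Z) //|]; lia.
by rewrite !IH2 ?addr0 //; lia.
Qed.

Lemma laurent_pos_lowpos f : f \in laurent_pos R -> exists p, lowpos f p.
Proof.
rewrite inE => -[f0 fge0].
have [s sf] : exists s, s \in finsupp f.
  have [E|[s]] := fset_0Vmem (finsupp f); last by exists s.
  case/eqP: f0; apply/laurentP => i; rewrite laurent0E fsfun_dflt //.
  by rewrite E in_fset0.
(* The exponent [s] rules out [+oo]; a minimum of integers and [+oo] is never [-oo]. *)
case E : (deg_minus f) => [p||].
- have /deg_minusP[fp fi] := E; exists p; split=> //.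
  by rewrite lt_neqAle eq_sym fp fge0.
- have : (deg_minus f <= s%:E)%E by rewrite /deg_minus (big_fsetD1 _ sf) /= ge_min lexx.
  by rewrite E.
exfalso; suff : deg_minus f != -oo%E by rewrite E.
rewrite /deg_minus; elim/big_ind: _ => // x y.
by rewrite /Order.min; case: ifP.
Qed.

Lemma laurent_pos_highpos f : f \in laurent_pos R -> exists q, highpos f q.
Proof.
rewrite inE => -[f0 fge0].
have [s sf] : exists s, s \in finsupp f.
  have [E|[s]] := fset_0Vmem (finsupp f); last by exists s.
  case/eqP: f0; apply/laurentP => i; rewrite laurent0E fsfun_dflt //.
  by rewrite E in_fset0.
case E : (deg_plus f) => [p||].
- have /deg_plusP[fp fi] := E; exists p; split=> //.
  by rewrite lt_neqAle eq_sym fp fge0.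
- exfalso; suff : deg_plus f != +oo%E by rewrite E.
  rewrite /deg_plus; elim/big_ind: _ => // x y.
  by rewrite /Order.max; case: ifP.
have : (s%:E <= deg_plus f)%E by rewrite /deg_plus (big_fsetD1 _ sf) /= le_max lexx.
by rewrite E.
Qed.

End LeadingCoefficients.

Lemma laurent_eval_gt0 (R : realFieldType) (f : laurent R) (r : R) :
  0 < r -> f \in laurent_pos R -> 0 < laurent_eval f r.
Proof.
move=> r0 fpos; have [p [fp _]] := laurent_pos_lowpos fpos.
move: fpos; rewrite inE => -[_ fge0].
have pf : p \in finsupp f by rewrite mem_finsupp gt_eqF.
rewrite /laurent_eval (big_fsetD1 _ pf) /= ltr_pwDl ?mulr_gt0 ?exprz_gt0 //.
by apply: sumr_ge0 => i _; rewrite mulr_ge0 // exprz_ge0 // ltW.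
Qed.

(** * Merging two Laurent polynomials *)

Section Glue.
Variable R : realType.
Implicit Types (f g : laurent R) (p q t : int) (x a b c d m : R).

Lemma bernoulli_ineq e N : 0 <= e -> 1 + N%:R * e <= (1 + e) ^+ N :> R.
Proof.
move=> e0; elim: N => [|N IH]; first by rewrite mul0r expr0 addr0.
rewrite exprS; have H : 0 <= 1 + e by lra.
apply: le_trans (ler_wpM2l H IH); rewrite -natr1.
have : 0 <= N%:R * e * e by rewrite !mulr_ge0.
lra.
Qed.

(** One factor [(x / c)^N] absorbs [x^t = c^t (x / c)^t] as soon as [N >= |t|]. The other exceeds
    the constant [|m| c^t] by Bernoulli's inequality, since [x / c >= b / c > 1]. *)
Lemma power_dominates b c m t : 0 < c -> c < b ->
  \forall N \near \oo, forall x, b <= x -> m * x ^ t < (x / c) ^+ N * (x / c) ^+ N.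
Proof.
move=> c0 cb; pose e := b / c - 1.
have e0 : 0 < e by rewrite subr_gt0 ltr_pdivlMr // mul1r.
near=> N => x bx.
have x0 : 0 < x by rewrite (lt_trans c0) // (lt_le_trans cb).
have bcx : b / c <= x / c by rewrite ler_pM2r // invr_gt0.
have bc1 : 1 <= b / c by rewrite -subr_ge0 ltW.
have xc1 : 1 <= x / c := le_trans bc1 bcx.
apply: (@le_lt_trans _ _ (`|m| * c ^ t * (x / c) ^+ N)).
  have -> : x ^ t = c ^ t * (x / c) ^ t.
    by rewrite -expfzMl mulrC divfK // gt_eqF.
  rewrite -mulrA; apply: le_trans (ler_wpM2r _ (ler_norm m)) _.
    by rewrite mulr_ge0 // exprz_ge0 // ltW // divr_gt0.
  have ct0 : 0 <= c ^ t by rewrite exprz_ge0 // ltW.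
  rewrite ler_wpM2l // ler_wpM2l //.
  rewrite exprnP; apply: ler_weXz2l => //.
  have : (`|t| <= N)%N by near: N; exact: nbhs_infty_ge.
  lia.
rewrite ltr_pM2r; last by rewrite exprn_gt0 // divr_gt0.
apply: (@lt_le_trans _ _ ((1 + e) ^+ N)); last first.
  by rewrite lerXn2r // ?nnegrE; rewrite /e; lra.
apply: lt_le_trans (bernoulli_ineq N (ltW e0)).
have : `|m| * c ^ t / e <= N%:R by near: N; exact: nbhs_infty_ger.
rewrite ler_pdivrMr //; lra.
Unshelve. all: by end_near.
Qed.

Definition lglue c (N : nat) f g : laurent R :=
  lmono (c ^+ N) (- N%:Z) * f + lmono (c^-1 ^+ N) N%:Z * g.

Lemma coef_glue c N f g i :
  lglue c N f g i = c ^+ N * f (i + N%:Z) + c^-1 ^+ N * g (i - N%:Z).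
Proof. by rewrite /lglue laurent_coefD !coef_lmonoM opprK. Qed.

Lemma glue_eval c N f g x : x != 0 -> laurent_eval (lglue c N f g) x =
  (c / x) ^+ N * laurent_eval f x + (x / c) ^+ N * laurent_eval g x.
Proof.
move=> x0; rewrite /lglue laurent_evalD !laurent_eval_lmonoM //.
by rewrite -exprnN -exprVn -exprnP -!exprMn [c^-1 * x]mulrC.
Qed.

Lemma glue_pos c N f g x : 0 < c -> 0 < x ->
  0 < laurent_eval f x -> 0 < laurent_eval g x -> 0 < laurent_eval (lglue c N f g) x.
Proof.
move=> c0 x0 fx gx; rewrite glue_eval ?gt_eqF //.
by rewrite addr_gt0 // mulr_gt0 // exprn_gt0 // divr_gt0.
Qed.

(** On [[b, oo)] compactness in [1 / x] gives [f(x) >= m x^t], with [m] of any sign. After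
    multiplication by [(x / c)^N] it remains to beat [- m x^t] by [(x / c)^(2N) d x^q]. The bound on
    [g] is assumed pointwise, so that [N] also serves when it holds only on part of the ray. *)
Lemma glue_pos_right b c d f g q : 0 < c -> c < b -> 0 < d ->
  \forall N \near \oo, forall x, b <= x ->
    d * x ^ q <= laurent_eval g x -> 0 < laurent_eval (lglue c N f g) x.
Proof.
move=> c0 cb d0; have b0 := lt_trans c0 cb.
have [t [_ ft]] := laurent_support_bound f.
have ib : 0 <= b^-1 by rewrite invr_ge0 ltW.
have [z _ zmin] := poly_min (lpoly f t) ib.
set m := (lpoly f t).[z] in zmin.
have H := power_dominates (- m / d) (t - q) c0 cb.
apply: filterS H => N H x bx gx; have x0 : 0 < x := lt_le_trans b0 bx.
have xn0 : x != 0 by rewrite gt_eqF.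
have fx : m * x ^ t <= laurent_eval f x.
  rewrite (laurent_eval_lpoly_rev xn0 ft) [leRHS]mulrC ler_pM2r ?exprz_gt0 //.
  by rewrite zmin // invr_ge0 ltW //= lef_pV2.
have y0 : 0 < (x / c) ^+ N by rewrite exprn_gt0 // divr_gt0.
rewrite glue_eval // -(pmulr_rgt0 _ y0) mulrDr mulrA -exprMn.
have -> : x / c * (c / x) = 1 by field; rewrite xn0 gt_eqF.
rewrite expr1n mul1r mulrA.
have xq0 : 0 < x ^ q by rewrite exprz_gt0.
have : - m * x ^ t < (x / c) ^+ N * (x / c) ^+ N * (d * x ^ q).
  have -> : - m * x ^ t = - m / d * x ^ (t - q) * (d * x ^ q).
    by rewrite expfzDr // -invr_expz; field; rewrite !gt_eqF.
  by rewrite ltr_pM2r ?mulr_gt0 // H.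
have := ler_wpM2l (ltW (mulr_gt0 y0 y0)) gx.
lra.
Qed.

(** Mirror image under [x -> 1 / x]: [power_dominates] is applied at [1 / x], with
    [1 / c < 1 / a]. *)
Lemma glue_pos_left a c d f g p : 0 < a -> a < c -> 0 < d ->
  \forall N \near \oo, forall x, 0 < x -> x <= a ->
    d * x ^ p <= laurent_eval f x -> 0 < laurent_eval (lglue c N f g) x.
Proof.
move=> a0 ac d0; have c0 := lt_trans a0 ac.
have [t [gt _]] := laurent_support_bound g.
have [z _ zmin] := poly_min (lpoly g (- t)) (ltW a0).
set m := (lpoly g (- t)).[z] in zmin.
have ic0 : 0 < c^-1 by rewrite invr_gt0.
have ica : c^-1 < a^-1 by rewrite ltf_pV2.
have H := power_dominates (- m / d) (p + t) ic0 ica.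
apply: filterS H => N H x x0 xa fx.
have xn0 : x != 0 by rewrite gt_eqF.
have gx : m * x ^ (- t) <= laurent_eval g x.
  rewrite (laurent_eval_lpoly xn0 gt) [leRHS]mulrC ler_pM2r ?exprz_gt0 //.
  by rewrite zmin // ltW.
have ax : a^-1 <= x^-1 by rewrite lef_pV2.
have y0 : 0 < (c / x) ^+ N by rewrite exprn_gt0 // divr_gt0.
have yy : (c / x) ^+ N * (x / c) ^+ N = 1.
  have xc1 : c / x * (x / c) = 1 by field; rewrite xn0 gt_eqF.
  by rewrite -exprMn xc1 expr1n.
rewrite glue_eval // -(pmulr_rgt0 _ y0) mulrDr !(mulrA ((c / x) ^+ N)) yy mul1r.
have xq0 : 0 < x ^ p by rewrite exprz_gt0.
have : - m * x ^ (- t) < (c / x) ^+ N * (c / x) ^+ N * (d * x ^ p).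
  have -> : - m * x ^ (- t) = - m / d * x^-1 ^ (p + t) * (d * x ^ p).
    by rewrite exprz_inv opprD expfzDr // -!invr_expz; field; rewrite !gt_eqF // exprz_gt0.
  by rewrite ltr_pM2r ?mulr_gt0 //; have := H _ ax; rewrite invrK [x^-1 * c]mulrC.
have := ler_wpM2l (ltW (mulr_gt0 y0 y0)) fx.
lra.
Qed.

(** Dividing by [x^p] leaves a polynomial with value [f p > 0] at 0, so compactness applies on the
    closed interval [[0, a]]. *)
Lemma eval_lb_near0 f p a : lowpos f p ->
  (forall x, 0 < x -> x <= a -> 0 < laurent_eval f x) ->
  exists2 d, 0 < d & forall x, 0 < x -> x <= a -> d * x ^ p <= laurent_eval f x.
Proof.
move=> [fp f0] fpos; have u0 : (lpoly f p)`_0 = f p by rewrite coef_lpoly // addr0.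
have [x /andP[]|d d0 H] := @poly_pos_lb _ (lpoly f p) 0 a.
  rewrite le_eqVlt => /predU1P[<- _|x0 xa]; first by rewrite horner_coef0 u0.
  have := fpos x x0 xa; rewrite (laurent_eval_lpoly _ f0) ?gt_eqF //.
  by rewrite pmulr_rgt0 // exprz_gt0.
exists d => // x x0 xa; rewrite (laurent_eval_lpoly _ f0) ?gt_eqF //.
by rewrite mulrC ler_pM2l ?exprz_gt0 // H // ltW.
Qed.

Lemma eval_lb_far f q b : 0 < b -> highpos f q ->
  (forall x, b <= x -> 0 < laurent_eval f x) ->
  exists2 d, 0 < d & forall x, b <= x -> d * x ^ q <= laurent_eval f x.
Proof.
move=> b0 [fq f0] fpos.
have u0 : (lpoly f q)`_0 = f q by rewrite coef_lpoly_rev // subr0.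
have [x /andP[]|d d0 H] := @poly_pos_lb _ (lpoly f q) 0 b^-1.
  rewrite le_eqVlt => /predU1P[<- _|x0 xb]; first by rewrite horner_coef0 u0.
  have bx : b <= x^-1 by rewrite -[b]invrK lef_pV2 // posrE invr_gt0.
  have := fpos _ bx; rewrite (laurent_eval_lpoly_rev _ f0) ?invrK; last first.
    by rewrite gt_eqF // invr_gt0.
  by rewrite pmulr_rgt0 // exprz_gt0 // invr_gt0.
exists d => // x bx; have x0 : 0 < x := lt_le_trans b0 bx.
rewrite (laurent_eval_lpoly_rev _ f0) ?gt_eqF //.
by rewrite mulrC ler_pM2l ?exprz_gt0 // H // invr_ge0 ltW //= lef_pV2.
Qed.

(** Away from 0 any lower bound of the support can serve as exponent. The conclusion has the shape
    of [eval_lb_far], so both feed the same merging lemma. *)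
Lemma eval_lb_segment f a b : 0 < a ->
  (forall x, a <= x <= b -> 0 < laurent_eval f x) ->
  exists p, exists2 d, 0 < d & forall x, a <= x <= b -> d * x ^ p <= laurent_eval f x.
Proof.
move=> a0 fpos; have [p [f0 _]] := laurent_support_bound f.
have pos x : a <= x <= b -> 0 < x by move=> /andP[ax _]; exact: lt_le_trans ax.
have [x xab|d d0 H] := @poly_pos_lb _ (lpoly f (- p)) a b.
  have x0 := pos x xab; have := fpos x xab.
  by rewrite (laurent_eval_lpoly _ f0) ?gt_eqF // pmulr_rgt0 // exprz_gt0.
exists (- p), d => // x xab; have x0 := pos x xab.
rewrite (laurent_eval_lpoly _ f0) ?gt_eqF //.
by rewrite mulrC ler_pM2l ?exprz_gt0 // H.
Qed.

Lemma glue_lowpos c f g p : 0 < c -> lowpos f p ->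
  \forall N \near \oo, lowpos (lglue c N f g) (p - N%:Z).
Proof.
move=> c0 [fp f0]; have [t [gt _]] := laurent_support_bound g.
(* The shifted [g] has no exponent below [N - t], which now exceeds [p - N]. *)
near=> N; have N1 : (`|(p + t)%R| < N)%N by near: N; exact: nbhs_infty_gt.
split=> [|i ip]; rewrite coef_glue.
  by rewrite subrK gt ?mulr0 ?addr0 ?mulr_gt0 ?exprn_gt0 //; lia.
by rewrite f0 ?gt ?mulr0 ?addr0 //; lia.
Unshelve. all: by end_near.
Qed.

Lemma glue_highpos c f g q : 0 < c -> highpos g q ->
  \forall N \near \oo, highpos (lglue c N f g) (q + N%:Z).
Proof.
move=> c0 [gq g0]; have [t [_ ft]] := laurent_support_bound f.
near=> N; have N1 : (`|(q - t)%R| < N)%N by near: N; exact: nbhs_infty_gt.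
split=> [|i ip]; rewrite coef_glue.
  rewrite addrK ft ?mulr0 ?add0r ?mulr_gt0 ?exprn_gt0 ?invr_gt0 //; lia.
by rewrite g0 ?ft ?mulr0 ?addr0 //; lia.
Unshelve. all: by end_near.
Qed.

End Glue.

(** * Positive elements of a submodule *)

Section Assembly.
Variable R : realType.
Implicit Types (f g : laurent R) (p q : int) (x a b d e r : R).

(** [E] delimits where [g] is controlled: [x <= r] when positivity is extended to [(0,r]],
    everything in the final merge. *)
Lemma glue_lowpos_pos a b d f g p q (E : pred R) : 0 < a -> a < b -> 0 < d ->
  lowpos f p ->
  (forall x, 0 < x -> x <= b -> 0 < laurent_eval f x) ->
  (forall x, a <= x -> E x -> 0 < laurent_eval g x) ->
  (forall x, b <= x -> E x -> d * x ^ q <= laurent_eval g x) ->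
  \forall N \near \oo, lowpos (lglue ((a + b) / 2) N f g) (p - N%:Z) /\
    forall x, 0 < x -> E x -> 0 < laurent_eval (lglue ((a + b) / 2) N f g) x.
Proof.
move=> a0 ab d0 fp fpos gpos gq; set c := (a + b) / 2.
have ac : a < c by rewrite /c; lra.
have cb : c < b by rewrite /c; lra.
have c0 := lt_trans a0 ac.
have [d' d'0 fd'] := eval_lb_near0 fp fpos.
near=> N; split; first by near: N; exact: glue_lowpos.
move=> x x0 Ex; have [xa|ax] := leP x a.
  have H : forall x, 0 < x -> x <= a -> d' * x ^ p <= laurent_eval f x ->
     0 < laurent_eval (lglue c N f g) x by near: N; exact: glue_pos_left.
  by apply: H => //; apply: fd' => //; lra.
have [bx|xb] := leP b x.
  have H : forall x, b <= x -> d * x ^ q <= laurent_eval g x ->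
     0 < laurent_eval (lglue c N f g) x by near: N; exact: glue_pos_right.
  by apply: H => //; apply: gq.
by apply: glue_pos => //; [apply: fpos|apply: gpos] => //; apply: ltW.
Unshelve. all: by end_near.
Qed.

(** Stated for all small [e > 0], so that finitely many coordinates can share one [e]. *)
Lemma poly_pos_near (u : {poly R}) z : 0 < u.[z] ->
  \forall e \near 0^'+, forall x, `|x - z| <= e -> 0 < u.[x].
Proof.
move=> uz; have /nbhs_ballP[e0 /= e00 H] : \forall x \near z, 0 < u.[x].
  by have := @continuous_horner R u z; move/cvgr_gt; apply.
near=> e => x xz; apply: H; rewrite /ball /= distrC; apply: le_lt_trans xz _.
by near: e; exact: nbhs_right_lt.
Unshelve. all: by end_near.
Qed.

Lemma lowpos_pos_near f p : lowpos f p ->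
  \forall e \near 0^'+, forall x, 0 < x -> x <= e -> 0 < laurent_eval f x.
Proof.
move=> [fp f0]; have : 0 < (lpoly f p).[0] by rewrite horner_coef0 coef_lpoly // addr0.
move/poly_pos_near; apply: filterS => e H x x0 xe.
rewrite (laurent_eval_lpoly _ f0) ?gt_eqF // mulr_gt0 ?exprz_gt0 // H //.
by rewrite subr0 gtr0_norm.
Qed.

Lemma highpos_pos_near f q : highpos f q ->
  \forall e \near 0^'+, forall x, e^-1 <= x -> 0 < laurent_eval f x.
Proof.
move=> [fq f0]; have : 0 < (lpoly f q).[0] by rewrite horner_coef0 coef_lpoly_rev // subr0.
move/poly_pos_near => H; near=> e => x ex.
have e0 : 0 < e by near: e; exact: nbhs_right_gt.
have x0 : 0 < x by rewrite (lt_le_trans _ ex) // invr_gt0.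
rewrite (laurent_eval_lpoly_rev _ f0) ?gt_eqF // mulr_gt0 ?exprz_gt0 //.
have He : forall x, `|x - 0| <= e -> 0 < (lpoly f q).[x] by near: e.
by apply: He; rewrite subr0 gtr0_norm ?invr_gt0 // -[e]invrK lef_pV2 // posrE invr_gt0.
Unshelve. all: by end_near.
Qed.

Lemma eval_pos_near f r : 0 < r -> 0 < laurent_eval f r ->
  \forall e \near 0^'+, forall x, 0 < x -> `|x - r| <= e -> 0 < laurent_eval f x.
Proof.
move=> r0; have [p [f0 _]] := laurent_support_bound f.
rewrite (laurent_eval_lpoly _ f0) ?gt_eqF // pmulr_rgt0 ?exprz_gt0 //.
move/poly_pos_near; apply: filterS => e H x x0 xr.
by rewrite (laurent_eval_lpoly _ f0) ?gt_eqF // mulr_gt0 ?exprz_gt0 // H.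
Qed.

Lemma polya_laurent f p q : lowpos f p -> highpos f q ->
  (forall x, 0 < x -> 0 < laurent_eval f x) ->
  \forall N \near \oo, forall i, 0 <= (X1 ^+ N * f) i.
Proof.
move=> [fp f0] [fq f1] fpos.
have pq : p <= q by rewrite leNgt; apply/negP => /f0 E; rewrite E ltxx in fq.
have H : \forall N \near \oo, forall k, 0 <= ((1 + 'X) ^+ N * lpoly f p)`_k.
  apply: (@polya _ _ `|(q - p)%R|%N).
  - by apply/leq_sizeP => k qk; rewrite coef_lpoly // f1 //; lia.
  - by rewrite coef_lpoly // addr0.
  - by rewrite coef_lpoly // (_ : p + _ = q) //; lia.
  move=> x x0; have := fpos x x0; rewrite (laurent_eval_lpoly _ f0) ?gt_eqF //.
  by rewrite pmulr_rgt0 // exprz_gt0.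
apply: filterS H => N H i; have [g0 gE] := lpoly_X1M N f0.
have [ip|pi] := ltP i p; first by rewrite g0.
have := H `|(i - p)%R|%N; rewrite -gE coef_lpoly //.
by rewrite (_ : p + _ = i) //; lia.
Qed.

(** * Vectors of the submodule: extending positivity and clearing negative coefficients *)

Variables (n : nat) (M : set 'rV[laurent R]_n) (iS iK : 'I_n).
Hypothesis hM : GRing.submod_closed [in M].
Implicit Type F G : 'rV[laurent R]_n.

Lemma submod_comb (s t : laurent R) F G : F \in M -> G \in M -> s *: F + t *: G \in M.
Proof.
move=> FM GM; have [M0 Mlin] := hM; apply: (Mlin s F (t *: G)) => //.
by have := Mlin t G 0 GM M0; rewrite addr0.
Qed.

Definition lowposv F := exists p : 'I_n -> int,
  (forall j, lowpos (F ord0 j) (p j)) /\ p iS <= p iK.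

Definition highposv F := exists q : 'I_n -> int,
  (forall j, highpos (F ord0 j) (q j)) /\ q iK <= q iS + 1.

Definition pos_upto b F :=
  [/\ F \in M, lowposv F & forall j x, 0 < x -> x <= b -> 0 < laurent_eval (F ord0 j) x].

Definition gluev c N F G : 'rV[laurent R]_n :=
  lmono (c ^+ N) (- N%:Z) *: F + lmono (c^-1 ^+ N) N%:Z *: G.

Lemma gluevE c N F G j : gluev c N F G ord0 j = lglue c N (F ord0 j) (G ord0 j).
Proof. by rewrite !mxE. Qed.

(** The overlap [[a, b]] leaves room for the merging point. A single [N] serves all coordinates, so
    all lowest exponents drop by the same amount and their comparison is kept. *)
Lemma extend_pos_upto a b r F G : 0 < a -> a < b -> pos_upto b F -> G \in M ->
  (forall j x, a <= x -> x <= r -> 0 < laurent_eval (G ord0 j) x) ->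
  exists H, pos_upto r H.
Proof.
move=> a0 ab [FM [p [Fp pSK]] Fpos] GM Gpos; set c := (a + b) / 2.
have H : \forall N \near \oo, forall j, lowpos (gluev c N F G ord0 j) (p j - N%:Z) /\
    forall x, 0 < x -> x <= r -> 0 < laurent_eval (gluev c N F G ord0 j) x.
  apply: filter_forall => j.
  have [|q [d d0 Gd]] := @eval_lb_segment _ (G ord0 j) b r (lt_trans a0 ab).
    by move=> x /andP[bx xr]; apply: Gpos => //; lra.
  have := @glue_lowpos_pos a b d (F ord0 j) (G ord0 j) (p j) q (fun x => x <= r) a0 ab d0
    (Fp j) (Fpos j) (Gpos j).
  have Gd' x : b <= x -> x <= r -> d * x ^ q <= laurent_eval (G ord0 j) x.
    by move=> bx xr; apply: Gd; rewrite bx.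
  by move/(_ Gd'); apply: filterS => N; rewrite gluevE.
have [N {}H] := filter_ex H; exists (gluev c N F G); split.
- exact: submod_comb.
- exists (fun j => p j - N%:Z); split; first by move=> j; case: (H j).
  by rewrite lerD2r.
- by move=> j x; case: (H j) => _; apply.
Qed.

(** If some [r] fails, the reachable bounds have a supremum; an element of [M] positive at it, hence
    around it, lets [extend_pos_upto] go past it. *)
Lemma pos_upto_all b F :
  (forall r, 0 < r -> exists2 G, G \in M & forall j, 0 < laurent_eval (G ord0 j) r) ->
  0 < b -> pos_upto b F -> forall r, exists G, pos_upto r G.
Proof.
move=> hr b0 Fb r; apply: contrapT => noG.
pose S := [set x : R | 0 < x /\ exists G, pos_upto x G].
have Sb : S b by split=> //; exists F.
have Sub : has_ubound S.
  exists r => x [x0 [G [GM Glow Gpos]]]; rewrite leNgt; apply/negP => rx.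
  apply: noG; exists G; split=> // j y y0 yr; apply: Gpos => //; lra.
have s0 : 0 < sup S by apply: lt_le_trans b0 _; exact: ub_le_sup.
have [G GM Gs] := hr _ s0.
have : \forall e \near 0^'+, forall j x, 0 < x -> `|x - sup S| <= e ->
    0 < laurent_eval (G ord0 j) x.
  by apply: filter_forall => j; apply: eval_pos_near.
(* [e < sup S] keeps the left end [sup S - e] of the overlap positive. *)
move=> near_s; have [e [e0 [es He]]] : exists e, 0 < e /\ (e < sup S /\
    forall j x, 0 < x -> `|x - sup S| <= e -> 0 < laurent_eval (G ord0 j) x).
  near (0 : R)^'+ => e; exists e; split; first by near: e; exact: nbhs_right_gt.
  by split; near: e => //; exact: nbhs_right_lt.
have [x [x0 [H Hx]] sx] := sup_adherent e0 (conj (ex_intro _ b Sb) Sub).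
have se0 : 0 < sup S - e by rewrite subr_gt0.
have [|K HK] := extend_pos_upto (r := sup S + e) se0 sx Hx GM.
  move=> j y ay yr; apply: He; first exact: lt_le_trans ay.
  by rewrite ler_norml; lra.
have : sup S + e <= sup S by apply: ub_le_sup => //; split; [lra|exists K].
lra.
Unshelve. all: by end_near.
Qed.

Lemma pos_everywhere F0 F1 :
  (forall r, 0 < r -> exists2 G, G \in M & forall j, 0 < laurent_eval (G ord0 j) r) ->
  F0 \in M -> lowposv F0 -> F1 \in M -> highposv F1 ->
  exists F, [/\ F \in M, lowposv F, highposv F &
    forall j x, 0 < x -> 0 < laurent_eval (F ord0 j) x].
Proof.
move=> hr F0M F0low F1M [q [F1q qSK]].
have [p0 [F0p _]] := F0low.
have [b [b0 F0b]] : exists b, 0 < b /\ pos_upto b F0.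
  have H : \forall e \near 0^'+, forall j x, 0 < x -> x <= e ->
      0 < laurent_eval (F0 ord0 j) x.
    by apply: filter_forall => j; exact: lowpos_pos_near (F0p j).
  near (0 : R)^'+ => e; exists e; split; first by near: e; exact: nbhs_right_gt.
  by split=> //; near: e.
have [a [a0 F1a]] : exists a, 0 < a /\ forall j x, a <= x -> 0 < laurent_eval (F1 ord0 j) x.
  have H : \forall e \near 0^'+, forall j x, e^-1 <= x ->
      0 < laurent_eval (F1 ord0 j) x.
    by apply: filter_forall => j; exact: highpos_pos_near (F1q j).
  near (0 : R)^'+ => e; exists e^-1; split; last by near: e.
  by rewrite invr_gt0; near: e; exact: nbhs_right_gt.
(* [F1] is positive from [a] on, so reaching [a + 1] creates an overlap of length 1 for the
   merge. *)
have [F [FM [p [Fp pSK]] Fpos]] := pos_upto_all hr b0 F0b (a + 1).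
have ab : a < a + 1 by lra.
set c := (a + (a + 1)) / 2.
have c0 : 0 < c by rewrite /c; lra.
have H : \forall N \near \oo, forall j,
    highpos (gluev c N F F1 ord0 j) (q j + N%:Z) /\
    (lowpos (gluev c N F F1 ord0 j) (p j - N%:Z) /\
    forall x, 0 < x -> true -> 0 < laurent_eval (gluev c N F F1 ord0 j) x).
  apply: filter_forall => j.
  have [|d d0 Gd] := @eval_lb_far _ (F1 ord0 j) (q j) (a + 1) (lt_trans a0 ab) (F1q j).
    by move=> x bx; apply: F1a; lra.
  under eq_near do rewrite gluevE.
  apply: filterI; first exact: glue_highpos.
  apply: (@glue_lowpos_pos a (a + 1) d _ _ (p j) (q j) xpredT) => //.
  - exact: Fpos.
  - by move=> x ax _; exact: F1a.
  - by move=> x bx _; exact: Gd.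
have [N {}H] := filter_ex H; exists (gluev c N F F1); split.
- exact: submod_comb.
- exists (fun j => p j - N%:Z); split; first by move=> j; case: (H j) => _ [].
  by rewrite lerD2r.
- exists (fun j => q j + N%:Z); split; first by move=> j; case: (H j).
  by rewrite addrAC lerD2r.
- by move=> j x x0; case: (H j) => _ [_]; apply.
Unshelve. all: by end_near.
Qed.

(** Polya's theorem holds for all large [N], so one power of [1 + X] suits every coordinate. It
    fixes the lowest exponents and raises all the highest ones by [N]. *)
Lemma nonneg_coefs F : F \in M -> lowposv F -> highposv F ->
  (forall j x, 0 < x -> 0 < laurent_eval (F ord0 j) x) ->
  exists G, [/\ G \in M, lowposv G, highposv G &
    forall j i, 0 <= G ord0 j i].
Proof.
move=> FM [p [Fp pSK]] [q [Fq qSK]] Fpos.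
have H : \forall N \near \oo, forall j i, 0 <= (X1 ^+ N * F ord0 j) i.
  by apply: filter_forall => j; exact: polya_laurent (Fp j) (Fq j) (Fpos j).
have [N {}H] := filter_ex H; exists (X1 ^+ N *: F); split.
- by have := submod_comb (X1 ^+ N) 0 FM FM; rewrite scale0r addr0.
- by exists p; split=> // j; rewrite mxE; exact: lowpos_X1M.
- exists (fun j => q j + N%:Z); split; first by move=> j; rewrite mxE; exact: highpos_X1M.
  by rewrite addrAC lerD2r.
- by move=> j i; rewrite mxE.
Qed.

Lemma lowposvP F : lowposv F <-> (forall j, 0 < lc_minus (F ord0 j)) /\
  (deg_minus (F ord0 iS) <= deg_minus (F ord0 iK))%E.
Proof.
split=> [[p [Fp pSK]]|[Fp FSK]].
  split=> [j|]; first by have [_ ->] := lowposP (Fp j); have [] := Fp j.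
  by have [-> _] := lowposP (Fp iS); have [-> _] := lowposP (Fp iK).
have [p {}Fp] := fin_all_exists (fun j => lc_minus_gt0 (Fp j)).
exists p; split=> //; move: FSK.
by have [-> _] := lowposP (Fp iS); have [-> _] := lowposP (Fp iK).
Qed.

Lemma highposvP F : highposv F <-> (forall j, 0 < lc_plus (F ord0 j)) /\
  (deg_plus (F ord0 iS) + 1 >= deg_plus (F ord0 iK))%E.
Proof.
split=> [[p [Fp pSK]]|[Fp FSK]].
  split=> [j|]; first by have [_ ->] := highposP (Fp j); have [] := Fp j.
  by have [-> _] := highposP (Fp iS); have [-> _] := highposP (Fp iK).
have [p {}Fp] := fin_all_exists (fun j => lc_plus_gt0 (Fp j)).
exists p; split=> //; move: FSK.
by have [-> _] := highposP (Fp iS); have [-> _] := highposP (Fp iK).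
Qed.

End Assembly.

Theorem proposition3p4 (R : realType) (n : nat) (hn : (n >= 3)%N)
    (M : set 'rV[laurent R]_n) (hM : GRing.submod_closed [in M])
    (iS iK : 'I_n) (hS : iS = 0%N :> nat) (hK : iK = 1%N :> nat) :
  (exists f : 'rV[laurent R]_n,
     [/\ f \in M,
         forall j, f ord0 j \in laurent_pos R,
         (deg_plus (f ord0 iS) + 1 >= deg_plus (f ord0 iK))%E &
         (deg_minus (f ord0 iS) <= deg_minus (f ord0 iK))%E])
  <->
  [/\ forall r : R, 0 < r ->
        exists2 f : 'rV[laurent R]_n,
          f \in M & forall j, 0 < laurent_eval (f ord0 j) r,
      exists f : 'rV[laurent R]_n,
        [/\ f \in M,
            forall j, 0 < lc_plus (f ord0 j) &
            (deg_plus (f ord0 iS) + 1 >= deg_plus (f ord0 iK))%E] &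
      exists f : 'rV[laurent R]_n,
        [/\ f \in M,
            forall j, 0 < lc_minus (f ord0 j) &
            (deg_minus (f ord0 iS) <= deg_minus (f ord0 iK))%E]].
Proof.
split=> [[f [fM fpos degp degm]]|[hr [f1 [f1M lc1 deg1]] [f0 [f0M lc0 deg0]]]].
  split.
  - by move=> r r0; exists f => // j; exact: laurent_eval_gt0.
  - exists f; split=> // j; have [q fq] := laurent_pos_highpos (fpos j).
    by have [_ ->] := highposP fq; case: fq.
  - exists f; split=> // j; have [p fp] := laurent_pos_lowpos (fpos j).
    by have [_ ->] := lowposP fp; case: fp.
have low0 : lowposv iS iK f0 by apply/lowposvP.
have high1 : highposv iS iK f1 by apply/highposvP.
have [f [fM flow fhigh fpos]] := pos_everywhere hM hr f0M low0 f1M high1.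
have [g [gM /lowposvP[glc gdeg] /highposvP[_ gdeg'] gge0]] :=
  nonneg_coefs hM fM flow fhigh fpos.
exists g; split=> // j; rewrite inE; split=> //.
(* A zero coordinate would have [lc_minus] equal to 0 by convention. *)
by apply: contraTneq (glc j) => ->; rewrite /lc_minus deg_minus0 ltxx.
Qed.
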